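(* Let $n\ge 1$, with the convention $\mathrm{TH}_2=\mathrm{PF}_1(1)=\emptyset$. Then the set $\mathrm{TH}_{n+1}$ of ideal states of the $(n+1)\times(n+1)$ Tower of Hanoi game and the set $\mathrm{PF}_n(1)$ of parking functions of length $n$ with displacement one are in bijection. Moreover, both sets are enumerated by the Lah numbers (OEIS A001286), i.e. $|\mathrm{TH}_{n+1}|=|\mathrm{PF}_n(1)|=\frac{n!\,(n-1)}{2}$.
   Context: Parking functions: for $n\in\mathbb{N}$, $n$ cars numbered $1,\dots,n$ enter in order a one-way street with spots $1,\dots,n$. Given a preference vector $\alpha=(a_1,\dots,a_n)\in[n]^n$ (where $[n]=\{1,\dots,n\}$), car $i$ drives to spot $a_i$ and parks there if it is free; otherwise it parks in the first free spot after $a_i$ (if none exists, it fails to park). $\alpha$ is a parking function of length $n$ if all cars park. If car $i$ parks in spot $p_i$, its displacement is $k_i=p_i-a_i$, and the displacement of $\alpha$ is $d(\alpha)=\sum_{i=1}^n k_i$. $\mathrm{PF}_n(1)$ is the set of parking functions of length $n$ with $d(\alpha)=1$. Tower of Hanoi: for $n\ge 2$, the $(n+1)\times(n+1)$ game has disks labeled $0,\dots,n$ by increasing size and pegs labeled $0,\dots,n$; on each peg disks are stacked with smaller disks above larger ones. An ideal state is an arrangement of all $n+1$ disks on the pegs such that: disk $n$ is alone on peg $0$; peg $n$ is the only empty peg; and the remaining $n$ disks lie on the interior pegs $1,\dots,n-1$ so that each interior peg has at least one disk (hence exactly one interior peg has two disks). $\mathrm{TH}_{n+1}$ denotes the set of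 distinct ideal states. *)

(* Defs.v *)
From mathcomp Require Import all_boot.

Set Implicit Arguments.
Unset Strict Implicit.
Unset Printing Implicit Defensive.

(** Spots and preferences are numbered [0 .. n-1] instead of [1 .. n]; this
    shift leaves parking outcomes and displacements unchanged. *)

Definition first_free (n : nat) (occ : seq nat) (a : nat) : option nat :=
  ohead [seq p <- iota 0 n | (a <= p) && (p \notin occ)].

(** [park n occ prefs] lists, in order of arrival, the spots taken by cars with
    preferences [prefs] when the spots in [occ] are already taken; it is [None]
    as soon as some car fails to park. *)
Fixpoint park (n : nat) (occ prefs : seq nat) : option (seq nat) :=
  if prefs is a :: prefs' then
    if first_free n occ a is Some p then
      omap (cons p) (park n (p :: occ) prefs')
    else None
  else Some [::].

Section ParkingFunctions.
Variable n : nat.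
Implicit Type alpha : n.-tuple 'I_n.

Definition outcome alpha : option (seq nat) :=
  park n [::] [seq val a | a <- alpha].

Definition is_parking_function alpha : bool := isSome (outcome alpha).

(** A car never parks before its preferred spot, so the subtraction does not
    truncate; the value on non-parking functions is irrelevant. *)
Definition displacement alpha : nat :=
  if outcome alpha is Some ps then
    \sum_(i < n) (nth 0 ps i - tnth alpha i)
  else 0.

Definition PF (k : nat) : {set n.-tuple 'I_n} :=
  [set alpha | is_parking_function alpha & displacement alpha == k].

End ParkingFunctions.

Section Hanoi.
Variable n : nat.

(** Each peg carries a stack of disks, listed from top to bottom. The length
    bound costs nothing, as there are only [n.+1] disks. *)
Definition configuration := {ffun 'I_n.+1 -> {bseq n.+1 of 'I_n.+1}}.

Implicit Type s : configuration.

Definition hanoi_state s : bool :=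
  [forall p, sorted (fun d e : 'I_n.+1 => d < e) (s p)]
  && perm_eq (flatten [seq (s p : seq 'I_n.+1) | p : 'I_n.+1])
             (enum 'I_n.+1).

Definition interior (p : 'I_n.+1) : bool := 0 < p < n.

Definition ideal s : bool :=
  [&& s ord0 == [:: ord_max] :> seq 'I_n.+1,
      [forall p, (s p == [::] :> seq 'I_n.+1) == (p == ord_max)],
      [forall d, (d != ord_max) ==> [exists p, interior p && (d \in s p)]]
    & [forall p, interior p ==> (s p != [::] :> seq 'I_n.+1)]].

(** The set usually indexed by the number [n.+1] of disks (and of pegs). *)
Definition TH : {set configuration} := [set s | hanoi_state s & ideal s].

End Hanoi.

(** For [n = 1] the definitions give empty sets, in agreement with the usual
    conventions. *)
Lemma TH1_empty : TH 1 = set0.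
Proof.
apply/setP=> s; rewrite !inE; apply/negP=> /andP[_] /and4P[_ _ /forallP H _].
have /existsP[p /andP[]] := implyP (H ord0) isT.
by rewrite /interior; case: p => [[|[|k]] kP].
Qed.

Lemma PF1_empty : PF 1 1 = set0.
Proof.
apply/setP=> a; rewrite !inE /is_parking_function /displacement /outcome.
case: a => [[|x [|y s]] sz] //=.
by rewrite (ord1 x) /= big_ord1 ord1.
Qed.

(* Main.v *)
(** An ideal state amounts to a surjection from the [n] smaller disks onto the
    [n-1] interior pegs.  In a parking function of displacement one, the unique
    displaced car prefers a spot [s] already preferred (and taken) by an earlier
    car, and parks in [s+1], which nobody prefers; closing that gap turns the
    preferences into a surjection from the [n] cars onto [n-1] values.  A
    surjection from [n] points onto [n-1] values is given by the pair of points
    [i < j] it identifies together with its bijective restriction away from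
    [j], whence the count [C(n, 2) * (n-1)!]. *)

Require Import Defs.
From mathcomp Require Import all_boot.
From mathcomp Require Import fingroup perm.

Set Implicit Arguments.
Unset Strict Implicit.
Unset Printing Implicit Defensive.

(** * Parking outcomes as permutations *)

Lemma first_freeP n occ a p :
  first_free n occ a = Some p <->
  [/\ a <= p < n, p \notin occ & forall q, a <= q < p -> q \in occ].
Proof.
rewrite /first_free; set r := filter _ _.
have rE q : q \in r = [&& a <= q, q \notin occ & q < n].
  by rewrite mem_filter mem_iota /= add0n -andbA.
have: sorted ltn r by apply: sorted_filter (iota_ltn_sorted _ _); apply: ltn_trans.
case: r rE => [|p' r] rE /=.
  by move=> _; split=> // -[/andP[ap pn] p_occ _]; have := rE p; rewrite ap p_occ pn.
move=> /(order_path_min ltn_trans)/allP ltp'.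
have := rE p'; rewrite mem_head => /esym/and3P[ap' p'_occ p'n].
split=> [[<-]|[/andP[ap pn] p_occ minp]].
  split=> [||q /andP[aq qp']]; rewrite ?ap' //.
  have := rE q; rewrite aq (ltn_trans qp' p'n) andbT.
  case: (q \in occ) => //; rewrite inE => /orP[/eqP qE|/ltp' /=].
    by rewrite qE ltnn in qp'.
  by rewrite ltnNge (ltnW qp').
have := rE p; rewrite ap p_occ pn inE => /orP[/eqP-> // | /ltp' /= p'p].
by case/negP: p'_occ; apply: minp; rewrite ap'.
Qed.

(** Replaces the recursion by one condition per car. [park] pushes each new spot in front of [occ],
    hence the [catrev]: it makes the induction go through by conversion. *)
Lemma parkP n occ prefs ps :
  park n occ prefs = Some ps <->
  size ps = size prefs /\
  forall i, i < size prefs ->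
    first_free n (catrev (take i ps) occ) (nth 0 prefs i) = Some (nth 0 ps i).
Proof.
elim: prefs occ ps => [|a prefs IH] occ [|p ps] /=.
- by split.
- by split=> // -[].
- by split=> [|[]//]; case: first_free => // p; case: park.
split.
  case Ep: first_free => [p'|] //; case Eps: park => [ps'|] //= [<- <-].
  have [sz_ps ffP] := (IH _ _).1 Eps; split=> [|[|i] ilt]; rewrite /= ?sz_ps //.
  exact: ffP.
move=> [[sz_ps] ffP]; have /= -> := ffP 0 isT.
rewrite ((IH _ ps).2 _) //; split=> // i ilt; exact: (ffP i.+1).
Qed.

(** The [n] cars take [n] distinct spots, so a successful outcome is a permutation. From here on,
    parking is handled without [park] or options. *)
Lemma mem_PF n k (alpha : n.-tuple 'I_n) :
  alpha \in PF n k <->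
  exists sigma : {perm 'I_n},
    [/\ forall i, tnth alpha i <= sigma i,
        forall i q, tnth alpha i <= q < sigma i ->
          exists2 l : 'I_n, l < i & q = sigma l
      & \sum_(i < n) (sigma i - tnth alpha i) = k].
Proof.
have nth_alpha (i : 'I_n) : nth 0 [seq val a | a <- alpha] i = tnth alpha i.
  by rewrite (nth_map i) ?size_tuple // -tnth_nth.
have sz_alpha : size [seq val a | a <- alpha] = n by rewrite size_map size_tuple.
rewrite inE /is_parking_function /displacement; split.
  rewrite /outcome; case Eps: park => [ps|] //= /eqP sumk.
  have [sz_ps ffP] := (parkP _ _ _ _).1 Eps.
  rewrite sz_alpha in sz_ps ffP.
  have {}ffP (i : 'I_n) : [/\ tnth alpha i <= nth 0 ps i < n,
      nth 0 ps i \notin take i ps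
    & forall q, tnth alpha i <= q < nth 0 ps i -> q \in take i ps].
    have /first_freeP := ffP i (ltn_ord i).
    rewrite nth_alpha catrevE cats0 mem_rev => -[? ? minp].
    by split=> // q /minp; rewrite mem_rev.
  have psn (i : 'I_n) : nth 0 ps i < n by have [/andP[]] := ffP i.
  pose p i := Ordinal (psn i).
  have lt_p (i l : 'I_n) : l < i -> p l != p i.
    move=> li; apply/eqP => -[pE]; have [_ /negP[]] := ffP i.
    rewrite -pE -(nth_take 0 li) mem_nth // size_take sz_ps.
    by case: ifP.
  have p_inj : injective p.
    move=> i l /eqP; have [/lt_p/negPf->//|/lt_p|/val_inj//] := ltngtP i l.
    by rewrite eq_sym => /negPf->.
  exists (perm p_inj); split=> [i|i q|].
  - by rewrite permE; have [/andP[]] := ffP i.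
  - rewrite permE /= => aqp; have [_ _ /(_ q aqp)] := ffP i.
    move=> /(nthP 0)[l]; rewrite size_take sz_ps ltn_ord => li.
    rewrite nth_take // => qE.
    by exists (Ordinal (ltn_trans li (ltn_ord i))); rewrite ?permE.
  - by rewrite -sumk; apply: eq_bigr => i _; rewrite permE.
case=> sigma [le_sigma min_sigma sumk].
pose ps := [seq val (sigma i) | i : 'I_n].
have nth_ps (i : 'I_n) : nth 0 ps i = sigma i.
  by rewrite (nth_map i) ?size_enum_ord // nth_ord_enum.
have sz_ps : size ps = n by rewrite size_map size_enum_ord.
have mem_take_ps (i : 'I_n) (q : nat) :
    reflect (exists2 l : 'I_n, l < i & q = sigma l) (q \in take i ps).
  apply: (iffP (nthP 0)) => [[l]|[l li ->]].
    rewrite size_take sz_ps ltn_ord => li; rewrite nth_take // => <-.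
    exists (Ordinal (ltn_trans li (ltn_ord i))) => //.
    by rewrite -nth_ps.
  by exists l; rewrite ?size_take ?sz_ps ?ltn_ord // nth_take.
have -> : outcome alpha = Some ps.
  apply/parkP; rewrite sz_alpha sz_ps; split=> // i ilt.
  rewrite -[i]/(val (Ordinal ilt)); move: (Ordinal ilt) => {ilt}i.
  apply/first_freeP; rewrite nth_alpha nth_ps catrevE cats0 mem_rev.
  rewrite le_sigma ltn_ord.
  split=> // [|q /min_sigma/mem_take_ps]; last by rewrite mem_rev.
  by apply/mem_take_ps => -[l li /val_inj/perm_inj il]; rewrite il ltnn in li.
by rewrite -sumk /=; apply/eqP/eq_bigr => i _; rewrite nth_ps.
Qed.

(** Closes the gap at [t]. It will be applied to the spots of all cars but the displaced one, with
    [t] the spot of the latter. *)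
Lemma avoiding_perm m (t : 'I_m.+1) (g : 'I_m -> 'I_m.+1) :
  injective g -> (forall v, g v != t) ->
  exists pi : {perm 'I_m}, forall v, g v = lift t (pi v).
Proof.
move=> g_inj g_t.
have /fin_all_exists[h gE] v : exists w, g v = lift t w.
  by have [w ->|gt] := unliftP t (g v); [exists w | case/eqP: (g_t v)].
have h_inj : injective h by move=> v w hvw; apply: g_inj; rewrite !gE hvw.
by exists (perm h_inj) => v; rewrite permE.
Qed.

(** * Surjections from [m+1] points onto [m], and their number *)

Section Merging.
Variable m : nat.
Implicit Types (x y : 'I_m.+1 * 'I_m * {perm 'I_m}).
Implicit Types (f : {ffun 'I_m.+1 -> 'I_m}).

(* [(j, i, pi)] encodes the map with [j] and [lift j i] in the same fiber and
   restriction [pi] away from [j]; as [lift j i < j] iff [i < j], the condition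
   makes [j] the larger of the two points. *)
Definition merge_data : {set 'I_m.+1 * 'I_m * {perm 'I_m}} :=
  [set x : 'I_m.+1 * 'I_m * {perm 'I_m} | x.1.2 < x.1.1].

(** [unlift] fails only at the point [j]; the default value then gives [j] the image of
    [lift j i]. *)
Definition merge x : {ffun 'I_m.+1 -> 'I_m} :=
  [ffun k => x.2 (odflt x.1.2 (unlift x.1.1 k))].

Definition surjections : {set {ffun 'I_m.+1 -> 'I_m}} :=
  [set f : {ffun 'I_m.+1 -> 'I_m} | [forall v, v \in codom f]].

Lemma surjectionsP f :
  reflect (forall v, exists k, f k = v) (f \in surjections).
Proof.
rewrite inE; apply: (iffP forallP) => f_surj v.
  by have /codomP[k ->] := f_surj v; exists k.
by have [k <-] := f_surj v; apply: codom_f.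
Qed.

Lemma merge_lift x v : merge x (lift x.1.1 v) = x.2 v.
Proof. by rewrite ffunE liftK. Qed.

Lemma merge_double x : merge x x.1.1 = x.2 x.1.2.
Proof. by rewrite ffunE unlift_none. Qed.

Lemma val_lift_gt (j : 'I_m.+1) (i : 'I_m) : i < j -> lift j i = i :> nat.
Proof. by move=> ij; rewrite /= /bump leqNgt ij. Qed.

(** Away from [j] the map is a permutation, so any collision involves [j], and its other point is
    [lift j i]. Thus the pair can be read off the map. *)
Lemma merge_collision x (k l : 'I_m.+1) : x \in merge_data ->
  k < l -> merge x k = merge x l -> x.1.1 = l /\ lift x.1.1 x.1.2 = k.
Proof.
rewrite inE => ij kl; have [a kE|kE] := unliftP x.1.1 k.
  have [b lE|->] := unliftP x.1.1 l.
    by rewrite kE lE !merge_lift => /perm_inj ab; rewrite kE lE ab ltnn in kl.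
  by rewrite kE merge_lift merge_double => /perm_inj->.
have [b lE|lE] := unliftP x.1.1 l; last by rewrite kE lE ltnn in kl.
(* Here [k] is [j] and [l] is [lift j i], of value [i < j], against [k < l]. *)
rewrite kE lE merge_lift merge_double => /perm_inj bE.
by move: kl; rewrite lE -bE val_lift_gt // kE ltnNge (ltnW ij).
Qed.

Lemma merge_inj : {in merge_data &, injective merge}.
Proof.
move=> x y xD yD xy.
have ij := yD; rewrite inE in ij.
have [||jE iE] := @merge_collision x (lift y.1.1 y.1.2) y.1.1 xD.
- by rewrite val_lift_gt.
- by rewrite xy merge_lift merge_double.
rewrite jE in iE; move/lift_inj: iE => iE.
have pE : x.2 = y.2 by apply/permP => v; rewrite -!merge_lift xy jE.
by move: x y jE iE pE {xD yD xy ij} => [[? ?] ?] [[? ?] ?] /= -> -> ->.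
Qed.

Lemma merge_surjective x : merge x \in surjections.
Proof.
apply/surjectionsP => v; exists (lift x.1.1 (x.2^-1%g v)).
by rewrite merge_lift permKV.
Qed.

Lemma imset_merge : merge @: merge_data = surjections.
Proof.
apply/setP => f; apply/imsetP/idP => [[x _ ->]|]; first exact: merge_surjective.
move=> /surjectionsP f_surj.
have [i [j [ij fij]]] : exists i j : 'I_m.+1, i < j /\ f i = f j.
  have /injectivePn[i [j ij fij]] : ~~ injectiveb f.
    by apply/negP => /injectiveP/leq_card; rewrite !card_ord ltnn.
  have [lt_ij|lt_ji|/val_inj ijE] := ltngtP i j; first by exists i, j.
    by exists j, i.
  by rewrite ijE eqxx in ij.
have [i' iE|iE] := unliftP j i; last by rewrite iE ltnn in ij.
(* Dropping [j] loses no value, since [i] has the same image. *)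
have fj_surj v : exists k, f (lift j k) = v.
  have [k <-] := f_surj v; have [k' ->|->] := unliftP j k; first by exists k'.
  by exists i'; rewrite -iE.
have /fin_all_exists[g gK] := fj_surj.
(* The section [g] is an injective self-map of a finite type, hence bijective; the map it is a
   section of is then its inverse, so injective. *)
have g_inj : injective g by exact: (@can_inj _ _ g (fun k => f (lift j k))).
have fj_inj : injective (fun k => f (lift j k)).
  have [h hK gh] := injF_bij g_inj.
  by apply: (can_inj (g := g)) => k; rewrite /= -{1}[k]gh gK gh.
exists (j, i', perm fj_inj).
  (* If [j <= i'], then [lift j i'] has value [i'+1 > j], against [i < j]. *)
  rewrite inE /= ltnNge; apply: contraL ij => ji.
  by rewrite iE /= /bump ji -leqNgt (leq_trans ji).
apply/ffunP => k; rewrite ffunE permE /=.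
by case: unliftP => [k' ->|->] //=; rewrite -iE fij.
Qed.

Lemma card_merge_data : #|merge_data| = (m.+1)`! * m %/ 2.
Proof.
have -> : #|merge_data| = 'C(m.+1, 2) * m`!.
  rewrite -card_Sn -[#|{: {perm _}}|]cardsT.
  have -> : merge_data = setX [set y : 'I_m.+1 * 'I_m | y.2 < y.1] setT.
    by apply/setP => x; rewrite !inE andbT.
  rewrite cardsX; congr (_ * _).
  rewrite -sum1_card (eq_bigl (fun z : 'I_m.+1 * 'I_m => xpredT z.1 && (z.2 < z.1))); last first.
    by move=> z; rewrite inE.
  rewrite -(pair_big_dep xpredT (fun (j : 'I_m.+1) (i : 'I_m) => i < j) (fun _ _ => 1)) /=.
  rewrite -bin2_sum big_mkord; apply: eq_bigr => j _.
  (* As [j] is at most [m], the bound [m] on [i] cuts nothing off: exactly [j] values of [i] lie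
     below [j]. *)
  have jm : j <= m by rewrite -ltnS.
  by rewrite -(big_ord_widen m (fun=> 1) jm) sum1_card card_ord.
(* The factor [2!] shows that the division by 2 is exact. *)
have -> : (m.+1)`! * m = 'C(m.+1, 2) * 2`! * m`!.
  by rewrite bin_ffact ffactnS ffactn1 factS mulnAC.
by rewrite mulnAC mulnK.
Qed.

(** * Parking functions of displacement one *)

(* The spot right after the doubled one is the only spot nobody prefers. *)
Definition preferences x : m.+1.-tuple 'I_m.+1 :=
  [tuple lift (lift ord0 (x.2 x.1.2)) (merge x k) | k < m.+1].

(** Since [merge x] is surjective, the gap is the only value missing from the preferences, so it can
    be recovered; removing it gives back [merge x]. *)
Lemma preferences_inj : {in merge_data &, injective preferences}.
Proof.
move=> x y xD yD xy.
have {}xy k : lift (lift ord0 (x.2 x.1.2)) (merge x k) =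
              lift (lift ord0 (y.2 y.1.2)) (merge y k).
  by have := congr1 (fun a => tnth a k) xy; rewrite !tnth_mktuple.
have tE : lift ord0 (x.2 x.1.2) = lift ord0 (y.2 y.1.2).
  have [v yE|//] := unliftP (lift ord0 (x.2 x.1.2)) (lift ord0 (y.2 y.1.2)).
  have /surjectionsP/(_ v)[k kE] := merge_surjective x.
  by have := neq_lift (lift ord0 (y.2 y.1.2)) (merge y k); rewrite -xy kE yE eqxx.
apply: merge_inj => //; apply/ffunP => k.
by move: (xy k); rewrite tE => /lift_inj.
Qed.

Lemma imset_preferences : preferences @: merge_data = PF m.+1 1.
Proof.
apply/setP => alpha; apply/imsetP/idP.
  move=> [x]; rewrite inE => ij ->; apply/mem_PF.
  (* Car [j] parks in the gap [t], every other car in the spot it prefers. *)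
  pose t := lift ord0 (x.2 x.1.2); exists (lift_perm x.1.1 t x.2).
  have val_t : t = (x.2 x.1.2).+1 :> nat by [].
  have pref_j : tnth (preferences x) x.1.1 = x.2 x.1.2 :> nat.
    by rewrite tnth_mktuple merge_double val_lift_gt // val_t.
  have pref_lift v : tnth (preferences x) (lift x.1.1 v) =
                     lift_perm x.1.1 t x.2 (lift x.1.1 v).
    by rewrite tnth_mktuple merge_lift lift_perm_lift.
  split=> [k|k q|].
  - have [v ->|->] := unliftP x.1.1 k; first by rewrite pref_lift.
    by rewrite pref_j lift_perm_id val_t.
  - have [v ->|->] := unliftP x.1.1 k.
      by rewrite pref_lift => /andP[/leq_ltn_trans h /h]; rewrite ltnn.
    rewrite pref_j lift_perm_id val_t ltnS -eqn_leq => /eqP <-.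
    exists (lift x.1.1 x.1.2); first by rewrite val_lift_gt.
    by rewrite lift_perm_lift val_lift_gt // val_t.
  - rewrite (bigD1 x.1.1) //= big1 => [|k].
      by rewrite pref_j lift_perm_id val_t subSnn.
    have [v -> _|->] := unliftP x.1.1 k; first by rewrite pref_lift subnn.
    by rewrite eqxx.
move=> /mem_PF[sigma [le_sigma min_sigma /eqP/sum_nat_eq1[j [_ dj d0]]]].
have sigma_j : sigma j = (tnth alpha j).+1 :> nat.
  by rewrite -(subnK (le_sigma j)) dj.
have alphaE k : k != j -> tnth alpha k = sigma k.
  move=> /d0/(_ isT)/eqP; rewrite subn_eq0 => le_k.
  by apply/val_inj/eqP; rewrite /= eqn_leq le_sigma.
(* The displaced car [j] drives past its preferred spot only; the earlier car [l] holding that spot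
   is the point to be merged with [j]. *)
have [|l lj alpha_j] := min_sigma j (tnth alpha j).
  by rewrite sigma_j !leqnn.
have [i lE|lE] := unliftP j l; last by rewrite lE ltnn in lj.
have [||pi piE] := @avoiding_perm m (sigma j) (fun v => sigma (lift j v)).
- by move=> v w /perm_inj/lift_inj.
- by move=> v; rewrite (inj_eq perm_inj) eq_sym neq_lift.
have ij : i < j.
  rewrite ltnNge; apply: contraL lj => ji.
  by rewrite lE /= /bump ji -leqNgt (leq_trans ji).
(* Spot [sigma l] lies just below [sigma j], so closing the gap at [sigma j] keeps its value, which
   is that of [pi i]. *)
have tE : sigma j = lift ord0 (pi i).
  apply: val_inj; move: sigma_j; rewrite alpha_j lE piE /= /bump.
  case: leqP => // le_pi jE; move: le_pi.
  by rewrite jE ltnNge leqnSn.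
exists (j, i, pi); first by rewrite inE.
apply: eq_from_tnth => k; rewrite tnth_mktuple /= -tE.
have [v ->|->] := unliftP j k.
  by rewrite (merge_lift (j, i, pi)) -piE alphaE // eq_sym neq_lift.
by rewrite (merge_double (j, i, pi)) -piE -lE; apply: val_inj.
Qed.

End Merging.

(** * Hanoi states as maps from disks to pegs *)

Section Stacking.
Variable n : nat.
Implicit Types (g : 'I_n.+1 -> 'I_n.+1) (s : configuration n).

Definition stack g (p : 'I_n.+1) : seq 'I_n.+1 :=
  [seq d <- enum 'I_n.+1 | g d == p].

Lemma size_stack g p : size (stack g p) <= n.+1.
Proof. by rewrite size_filter (leq_trans (count_size _ _)) // size_enum_ord. Qed.

Definition state_of g : configuration n := [ffun p => Bseq (size_stack g p)].

Lemma state_ofE g p : state_of g p = stack g p :> seq _.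
Proof. by rewrite ffunE. Qed.

Lemma mem_stack g p d : (d \in stack g p) = (g d == p).
Proof. by rewrite mem_filter mem_enum andbT. Qed.

Lemma mem_state_of g p d : (d \in state_of g p) = (g d == p).
Proof. by rewrite -mem_stack -state_ofE. Qed.

Lemma stack_uniq g p : uniq (stack g p).
Proof. exact: filter_uniq (enum_uniq _). Qed.

Lemma stack_nil g p : (stack g p == [::]) = ~~ [exists d, g d == p].
Proof.
apply/eqP/existsPn => [st0 d|gp]; first by rewrite -mem_stack st0.
by case E: (stack g p) => [//|d r]; case/negP: (gp d); rewrite -mem_stack E mem_head.
Qed.

Lemma stack_sorted g p : sorted (fun d e : 'I_n.+1 => d < e) (stack g p).
Proof.
apply: sorted_filter; first by move=> ? ? ?; apply: ltn_trans.
by rewrite -(@sorted_map _ _ val ltn) val_enum_ord iota_ltn_sorted.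
Qed.

Lemma state_of_inj g1 g2 : state_of g1 = state_of g2 -> g1 =1 g2.
Proof.
move=> eq_st d; apply/esym/eqP.
by rewrite -mem_state_of -eq_st mem_state_of.
Qed.

Lemma count_pegs s d :
  count_mem d (flatten [seq (s p : seq 'I_n.+1) | p : 'I_n.+1]) =
  \sum_p count_mem d (s p).
Proof. by rewrite count_flatten sumnE !big_map -big_enum. Qed.

Lemma hanoi_state_of g : hanoi_state (state_of g).
Proof.
apply/andP; split.
  by apply/forallP => p; rewrite state_ofE stack_sorted.
apply/allP => d _ /=; rewrite count_pegs (count_uniq_mem _ (enum_uniq _)) mem_enum.
rewrite (bigD1 (g d)) //= big1 => [|p /negPf gd].
  by rewrite state_ofE count_uniq_mem ?stack_uniq // mem_stack eqxx.
by rewrite state_ofE count_uniq_mem ?stack_uniq // mem_stack eq_sym gd.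
Qed.

(** Each disk has total count one over all pegs, so it lies on exactly one; sortedness then
    determines every stack from its set of disks. *)
Lemma hanoi_stateP s : hanoi_state s -> exists g, s = state_of g.
Proof.
move=> /andP[/forallP s_sorted /seq.permP s_perm].
have /fin_all_exists[g gP] d : exists p, forall p', (d \in s p') = (p == p').
  have := s_perm (pred1 d).
  rewrite count_pegs (count_uniq_mem _ (enum_uniq _)) mem_enum => /eqP/sum_nat_eq1.
  move=> [p [_ dp d0]]; exists p => p'.
  have [<-|pp'] := eqVneq p p'; first by rewrite -has_pred1 has_count dp.
  by apply/negP; rewrite -has_pred1 has_count d0 // eq_sym.
exists g; apply/ffunP => p; apply/val_inj; rewrite /= state_ofE.
apply: (@irr_sorted_eq _ (fun d e : 'I_n.+1 => d < e)).
- by move=> ? ? ?; apply: ltn_trans.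
- by move=> ?; apply: ltnn.
- exact: s_sorted.
- exact: stack_sorted.
- by move=> d; rewrite mem_stack gP.
Qed.

End Stacking.

(** * Ideal states as surjections *)

Section IdealStates.
Variable m : nat.

(** With [m+2] pegs, the outer [lift] skips the first one and the inner [lift] the last one. *)
Definition interior_peg (v : 'I_m) : 'I_m.+2 := lift ord0 (lift ord_max v).

Lemma val_interior_peg v : interior_peg v = v.+1 :> nat.
Proof. by rewrite lift0 lift_max. Qed.

Lemma interior_peg_inj : injective interior_peg.
Proof. by move=> v w /lift_inj/lift_inj. Qed.

Lemma interiorP (p : 'I_m.+2) :
  reflect (exists v, p = interior_peg v) (interior p).
Proof.
apply: (iffP andP) => [[p0 pm]|[v ->]]; last first.
  by rewrite val_interior_peg !ltnS ltn_ord.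
have pE : p.-1.+1 = p by rewrite prednK.
have vm : p.-1 < m by rewrite -ltnS pE.
by exists (Ordinal vm); apply: ord_inj; rewrite val_interior_peg pE.
Qed.

Definition peg_of (f : {ffun 'I_m.+1 -> 'I_m}) (d : 'I_m.+2) : 'I_m.+2 :=
  if unlift ord_max d is Some k then interior_peg (f k) else ord0.

Lemma peg_of_max f : peg_of f ord_max = ord0.
Proof. by rewrite /peg_of unlift_none. Qed.

Lemma peg_of_lift f k : peg_of f (lift ord_max k) = interior_peg (f k).
Proof. by rewrite /peg_of liftK. Qed.

Lemma peg_of_inj f1 f2 : peg_of f1 =1 peg_of f2 -> f1 = f2.
Proof.
move=> eq_f; apply/ffunP => k; apply: interior_peg_inj.
by rewrite -!peg_of_lift eq_f.
Qed.

Lemma ideal_state_of f :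
  f \in surjections m -> ideal (state_of (peg_of f)).
Proof.
move=> /surjectionsP f_surj.
have nonempty v : [exists d, peg_of f d == interior_peg v].
  by have [k <-] := f_surj v; apply/existsP; exists (lift ord_max k); rewrite peg_of_lift.
apply/and4P; split.
- rewrite state_ofE /stack (eq_filter (a2 := pred1 ord_max)) => [|d].
    by rewrite filter_pred1_uniq ?enum_uniq // mem_enum.
  rewrite /=; have [k ->|->] := unliftP ord_max d; last by rewrite peg_of_max !eqxx.
  by rewrite peg_of_lift eq_sym [RHS]eq_sym !(negPf (neq_lift _ _)).
- apply/forallP => p; rewrite state_ofE stack_nil; apply/eqP.
  have [->|pm] := eqVneq p ord_max.
    (* An interior peg has value at most [m], the last peg [m+1]. *)
    apply/existsPn => d; rewrite /peg_of; case: unlift => [k|] //.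
    apply/eqP => /(congr1 (@nat_of_ord _)); rewrite val_interior_peg => -[fkE].
    by have := ltn_ord (f k); rewrite fkE ltnn.
  apply/negbTE; rewrite negbK; have [->|p0] := eqVneq p ord0.
    by apply/existsP; exists ord_max; rewrite peg_of_max.
  have /interiorP[v ->] : interior p; last exact: nonempty.
  by rewrite /interior lt0n p0 ltn_neqAle pm -ltnS ltn_ord.
- apply/forallP => d; apply/implyP; have [k -> _|->] := unliftP ord_max d.
    apply/existsP; exists (interior_peg (f k)).
    rewrite mem_state_of peg_of_lift eqxx andbT.
    by apply/interiorP; exists (f k).
  by rewrite eqxx.
- apply/forallP => p; apply/implyP => /interiorP[v ->].
  by rewrite state_ofE stack_nil negbK.
Qed.

(** The largest disk is fixed on the first peg and the others are confined to the interior, so only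
    a map [f] between these remains to be chosen; occupied interior pegs mean that [f] is onto. *)
Lemma imset_state_of :
  [set state_of (peg_of f) | f in surjections m] = TH m.+1.
Proof.
apply/setP => s; rewrite inE; apply/imsetP/andP => [[f fS ->]|].
  by rewrite hanoi_state_of ideal_state_of.
move=> [/hanoi_stateP[g ->] /and4P[/eqP g0 _ /forallP g_int /forallP int_g]].
have g_max : g ord_max = ord0.
  by apply/eqP; rewrite -mem_stack -state_ofE g0 mem_head.
have /fin_all_exists[f fP] k : exists v, g (lift ord_max k) = interior_peg v.
  have /implyP/(_ _)/existsP[|p /andP[/interiorP[v ->]]] := g_int (lift ord_max k).
    by rewrite eq_sym neq_lift.
  by rewrite mem_state_of => /eqP; exists v.
have g_f : g =1 peg_of (finfun f).
  move=> d; have [k ->|->] := unliftP ord_max d; last by rewrite peg_of_max.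
  by rewrite peg_of_lift ffunE.
exists (finfun f).
  apply/surjectionsP => v.
  have /implyP := int_g (interior_peg v).
  rewrite state_ofE stack_nil negbK => /(_ _)/existsP[|d].
    by apply/interiorP; exists v.
  rewrite g_f; have [k ->|->] := unliftP ord_max d; last by rewrite peg_of_max.
  by rewrite peg_of_lift => /eqP/interior_peg_inj; exists k.
apply/ffunP => p; apply: val_inj; rewrite /= !state_ofE.
by apply: eq_filter => d; rewrite g_f.
Qed.

Lemma card_TH : #|TH m.+1| = #|merge_data m|.
Proof.
rewrite -imset_state_of card_imset => [|f1 f2 /state_of_inj/peg_of_inj//].
by rewrite -imset_merge card_in_imset //; apply: merge_inj.
Qed.

Lemma card_PF1 : #|PF m.+1 1| = #|merge_data m|.
Proof.
by rewrite -imset_preferences card_in_imset //; apply: preferences_inj.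
Qed.

End IdealStates.

(** * The bijection from equal cardinalities *)

Lemma eq_card_bij (T1 T2 : finType) :
  #|T1| = #|T2| -> exists f : T1 -> T2, bijective f.
Proof.
move=> eqT; exists (fun x => enum_val (cast_ord eqT (enum_rank x))).
exists (fun y => enum_val (cast_ord (esym eqT) (enum_rank y))) => x.
  by rewrite enum_valK cast_ordK enum_rankK.
by rewrite enum_valK cast_ordKV enum_rankK.
Qed.

Theorem theorem1 (n : nat) (n_ge1 : 1 <= n) :
  (exists f : {s : configuration n | s \in TH n} ->
              {alpha : n.-tuple 'I_n | alpha \in PF n 1}, bijective f)
  /\ #|TH n| = (n`! * (n - 1)) %/ 2
  /\ #|PF n 1| = (n`! * (n - 1)) %/ 2.
Proof.
(* Both sets are counted by [merge_data m]; the convention for [n = 1] is the case [m = 0], where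
   the formula gives 0. *)
case: n n_ge1 => // m _; rewrite subn1 card_TH card_PF1 card_merge_data.
by split=> //; apply: eq_card_bij; rewrite !card_sig card_TH card_PF1.
Qed.
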